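(* There is an absolute constant $0<c<1$ such that for every integer $q\ge 3$ the following holds. For each $n$, generate a random spanoid $\mathcal S$ on $[n]$ as follows: independently for each $i\in[n]$, choose uniformly at random a collection $M_i$ of $\lfloor n/(2q)\rfloor$ pairwise disjoint $q$-element subsets of $[n]$, and let $\mathcal S=\{(T,i): i\in[n],\,T\in M_i\}$. Then the probability that $\mathrm{rank}(\mathcal S)> c\,n^{\frac{q-2}{q-1}}/\log_2 n$ tends to $1$ as $n\to\infty$.
   Context: A spanoid $\mathcal S$ on $[n]=\{1,\dots,n\}$ is a family of pairs $(S,i)$ with $S\subseteq[n]$, $i\in[n]$ (rules). For $T\subseteq[n]$ and $i\in[n]$ write $T\models i$ if there is a sequence $T=T_0,T_1,\dots,T_r$ ($r\ge 0$) with $i\in T_r$ such that for each $j\in[r]$, $T_j=T_{j-1}\cup\{i_j\}$ for some $i_j\in[n]$ for which there is $S\subseteq T_{j-1}$ with $(S,i_j)\in\mathcal S$. $\mathrm{span}(T)=\{i: T\models i\}$, and $\mathrm{rank}(\mathcal S)$ is the minimum size of $T\subseteq[n]$ with $\mathrm{span}(T)=[n]$. *)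

(* Defs.v *)
From mathcomp Require Import all_boot all_order all_algebra.
From mathcomp Require Import all_classical all_reals all_analysis.

Set Implicit Arguments.
Unset Strict Implicit.
Unset Printing Implicit Defensive.

Import Order.TTheory GRing.Theory Num.Theory.
Import numFieldNormedType.Exports.

Local Open Scope ring_scope.

(* The ground set [n] = {1, ..., n} is represented by 'I_n = {0, ..., n-1}. *)
Definition spanoid (n : nat) : Type := {set {set 'I_n} * 'I_n}.

Definition spanoid_step (n : nat) (S : spanoid n) : rel {set 'I_n} :=
  fun A B => [exists i : 'I_n, (B == i |: A) &&
                [exists U : {set 'I_n}, (U \subset A) && ((U, i) \in S)]].

(* [connect] is the existence of a finite, possibly empty, path of steps. *)
Definition spanoid_entails (n : nat) (S : spanoid n) (T : {set 'I_n}) (i : 'I_n) : bool :=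
  [exists U : {set 'I_n}, connect (spanoid_step S) T U && (i \in U)].

Definition spanoid_span (n : nat) (S : spanoid n) (T : {set 'I_n}) : {set 'I_n} :=
  [set i | spanoid_entails S T i].

(* The default [set: 'I_n] of the arg min always spans, see [spanoid_span_setT]. *)
Definition spanoid_rank (n : nat) (S : spanoid n) : nat :=
  #|[arg min_(T < [set: 'I_n] | spanoid_span S T == [set: 'I_n]) #|T| ]|.

Lemma spanoid_span_setT (n : nat) (S : spanoid n) : spanoid_span S [set: 'I_n] = [set: 'I_n].
Proof.
apply/setP => i; rewrite !inE; apply/existsP.
by exists [set: 'I_n]%SET; rewrite connect0 inE.
Qed.

Lemma spanoid_rank_min (n : nat) (S : spanoid n) :
  (exists2 T : {set 'I_n}, spanoid_span S T = [set: 'I_n] & #|T| = spanoid_rank S) /\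
  (forall T : {set 'I_n}, spanoid_span S T = [set: 'I_n] -> (spanoid_rank S <= #|T|)%N).
Proof.
rewrite /spanoid_rank; case: arg_minnP => [|T /eqP spT minT]; first by rewrite spanoid_span_setT.
by split=> [|U /eqP]; [exists T | exact: minT].
Qed.

(* The collections of k pairwise disjoint q-element subsets of [n]. *)
Definition matchings (n q k : nat) : {set {set {set 'I_n}}} :=
  [set M : {set {set 'I_n}} |
    [&& #|M| == k, finset.trivIset M & [forall B in M, #|B| == q]]].

Definition spanoid_of (n : nat) (M : {ffun 'I_n -> {set {set 'I_n}}}) :
  spanoid n := [set p : {set 'I_n} * 'I_n | p.1 \in M p.2].

Definition uniform_mass (R : realType) (T : finType) (A : {set T}) (x : T) : R :=
  if x \in A then (#|A|%:R)^-1 else 0.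

(* Independence of the M i: the law of M is the product of the laws of the M i. *)
Definition random_spanoid_prob (R : realType) (n q : nat) (E : pred (spanoid n)) : R :=
  \sum_(M : {ffun 'I_n -> {set {set 'I_n}}} | E (spanoid_of M))
    \prod_(i < n) uniform_mass R (matchings n q (n %/ (2 * q))%N) (M i).

Definition log2 (R : realType) (x : R) : R := ln x / ln 2.

(* Main.v *)
(** A set [T] of size at most [r] that spans yields, by recording the first [s]
    derived elements, sets [T] and [I] of sizes [r] and [s] such that for every
    [i] in [I] some member of [M i] lies inside [T :|: I].  For fixed [T] and
    [I], independence and symmetry bound the probability of this by
    [(k * ((r + s) / n) ^ q) ^ s] with [k = n %/ (2 * q)], and a union bound over
    [T] and [I] costs at most [n ^ r * (4 * n / s) ^ s].  With
    [X = n ^ ((q - 2) / (q - 1))], [s] about [X / 8] and [r] about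
    [X / (16 * log2 n)] the base of the [s]-th power is at most [1 / 4] while
    [n ^ r <= 2 ^ s], so the failure probability is at most [2 ^ - s]. *)

Require Import Defs.
From mathcomp Require Import all_boot all_order all_algebra all_fingroup.
From mathcomp Require Import all_classical all_reals all_analysis.
From mathcomp Require Import zify ring lra.

Set Implicit Arguments.
Unset Strict Implicit.
Unset Printing Implicit Defensive.

Import Order.TTheory GRing.Theory Num.Theory.
Import numFieldNormedType.Exports.

Local Open Scope ring_scope.

(** * Matchings: existence, symmetry and counting *)

Lemma set_between (T : finType) (A B : {set T}) k :
  A \subset B -> (#|A| <= k <= #|B|)%N ->
  exists C : {set T}, [/\ A \subset C, C \subset B & #|C| = k].
Proof.
move=> AB /andP[]; elim: k => [|k IHk].
  by rewrite leqn0 => /eqP A0 _; exists A.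
rewrite leq_eqVlt => /orP[/eqP Ak _|Ak kB]; first by exists A.
have [C [AC CB Ck]] := IHk Ak (ltnW kB).
have /properP[_ [x xB xC]] : C \proper B by rewrite properEcard CB Ck.
exists (x |: C)%SET; split; last by rewrite cardsU1 xC Ck.
- exact: fintype.subset_trans AC (finset.subsetUr _ _).
- by rewrite finset.subUset CB finset.sub1set xB.
Qed.

(** List [A] followed by its complement, likewise [B], and match equal positions; equal cardinality
    sends the first block onto the first block. *)
Lemma perm_imset_exists (T : finType) (A B : {set T}) :
  #|A| = #|B| -> exists s : {perm T}, (s @: A)%SET = B.
Proof.
move=> cAB; pose l (C : {set T}) := enum C ++ enum (~: C)%SET.
have mem_l C x : x \in l C by rewrite mem_cat !mem_enum !inE orbN.
have uniq_l C : uniq (l C).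
  rewrite cat_uniq !enum_uniq andbT /=; apply/hasPn => x.
  by rewrite !mem_enum !inE.
have size_l C : size (l C) = #|T|.
  by rewrite -(card_uniqP (uniq_l C)); apply: eq_card => x; rewrite mem_l.
pose f x := nth x (l B) (index x (l A)).
have f_inj : injective f.
  move=> x y /eqP; rewrite /f (set_nth_default x y) ?size_l -?(size_l A) ?index_mem //.
  rewrite nth_uniq ?size_l -?(size_l A) ?index_mem // => /eqP xy.
  by rewrite -[x](nth_index x (mem_l A x)) xy nth_index.
exists (perm f_inj); apply/eqP; rewrite eqEcard.
rewrite (card_imset _ (@perm_inj _ _)) cAB leqnn andbT.
apply/fintype.subsetP => _ /imsetP[x xA ->]; rewrite permE /f index_cat mem_enum xA.
have ix : (index x (enum A) < size (enum B))%N.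
  by rewrite -cardE -cAB cardE index_mem mem_enum.
by rewrite nth_cat ix -mem_enum mem_nth.
Qed.

(** Needed for the uniform law to have total mass 1. Greedy: [k] disjoint [q]-sets cover only
    [k * q] points, so one more [q]-set fits in the complement. *)
Lemma matchings_gt0 n q k :
  (0 < q)%N -> (k * q <= n)%N -> (0 < #|matchings n q k|)%N.
Proof.
move=> q0; elim: k => [|k IHk] kn.
  apply/card_gt0P; exists finset.set0; rewrite inE cards0 eqxx /=.
  rewrite (_ : finset.trivIset _) /=; first by apply/forallP => B; rewrite inE.
  by apply/finset.trivIsetP => ?; rewrite inE.
have /card_gt0P[M] := IHk (leq_trans (leq_mul (leqnSn k) (leqnn q)) kn).
rewrite inE => /and3P[/eqP Mk Mtriv /forallP Mq].
have cM : #|finset.cover M| = (k * q)%N.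
  rewrite -(eqP Mtriv) -Mk -sum_nat_const; apply: eq_bigr => B BM.
  exact/eqP/(implyP (Mq B)).
have cMC : (q <= #|(~: finset.cover M)%SET|)%N by rewrite cardsCs finset.setCK cM card_ord; lia.
have [|B [_ BM Bq]] := @set_between _ finset.set0 (~: finset.cover M)%SET q (finset.sub0set _).
  by rewrite cards0.
have BX C : C \in M -> [disjoint B & C].
  move=> CM; rewrite finset.disjoints_subset.
  apply: (fintype.subset_trans BM); rewrite finset.setCS.
  exact: finset.bigcup_sup.
have [||BMtriv BnM] := @trivIsetU1 _ B M _ Mtriv; first by move=> C /BX.
  (* As [q > 0], the empty set is not a member; hence a [B] disjoint from all members is a new
     one. *)
  by apply/negP => M0; move: (Mq finset.set0) q0; rewrite M0 cards0 => /eqP <-.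
apply/card_gt0P; exists (B |: M)%SET; rewrite inE BMtriv cardsU1 BnM Mk eqxx /=.
apply/forallP => C; rewrite in_setU1; apply/implyP => /orP[/eqP ->|CM]; first by rewrite Bq.
exact: (implyP (Mq C)).
Qed.

Lemma matchings_imset n q k (s : {perm 'I_n}) (M : {set {set 'I_n}}) :
  ([set s @: B | B : {set 'I_n} in M]%SET \in matchings n q k) = (M \in matchings n q k).
Proof.
have injs := imset_inj (@perm_inj _ s).
rewrite !inE (card_imset _ injs); congr [&& _, _ & _].
  exact: imset_trivIset (@perm_inj _ s).
apply/forallP/forallP => Mq B; apply/implyP => BM.
  by have := Mq (s @: B)%SET; rewrite (mem_imset _ _ injs) BM (card_imset _ (@perm_inj _ s)).
case/imsetP: BM => C CM ->; rewrite (card_imset _ (@perm_inj _ s)).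
exact: implyP (Mq C) CM.
Qed.

Definition matchings_through n q k (B : {set 'I_n}) :=
  [set M in matchings n q k | B \in M]%SET.

(** A permutation carrying [A] to [B] maps matchings through [A] injectively to matchings through
    [B]. *)
Lemma card_matchings_through n q k (A B : {set 'I_n}) :
  #|A| = #|B| -> #|matchings_through q k A| = #|matchings_through q k B|.
Proof.
wlog suff: A B / #|A| = #|B| ->
    (#|matchings_through q k A| <= #|matchings_through q k B|)%N.
  by move=> H cAB; apply/eqP; rewrite eqn_leq !H.
move=> /perm_imset_exists[s <-].
pose f (M : {set {set 'I_n}}) := [set s @: B | B : {set 'I_n} in M]%SET.
have injs := imset_inj (@perm_inj _ s).
rewrite -(card_imset _ (imset_inj injs)); apply/subset_leq_card/fintype.subsetP.
move=> _ /imsetP[M + ->]; rewrite inE => /andP[MM AM].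
by rewrite inE matchings_imset MM mem_imset.
Qed.

(** Double counting of the pairs of a matching and one of its [k] members. *)
Lemma sum_matchings_through (n q k : nat) :
  (\sum_(B : {set 'I_n} | #|B| == q) #|matchings_through q k B| =
   #|matchings n q k| * k)%N.
Proof.
under eq_bigr => B _ do rewrite -sum1_card.
rewrite (exchange_big_dep (mem (matchings n q k))) /=; last first.
  by move=> B M _; rewrite inE => /andP[].
rewrite -sum_nat_const; apply: eq_bigr => M MM.
move: (MM); rewrite [in X in X -> _]inE => /and3P[/eqP Mk _ /forallP Mq].
rewrite -[RHS]Mk -sum1_card; apply: eq_bigl => B; rewrite [M \in _]inE MM /=.
by apply/andP/idP => [[]|BM] //; split=> //; apply: (implyP (Mq B)).
Qed.

(* By symmetry every q-set lies in the same number of matchings; the factor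
   'C(#|W|, q) comes from a union bound over the q-subsets of W. *)
Lemma card_matchings_sub n q k (W : {set 'I_n}) :
  (#|[set M in matchings n q k | [exists B in M, B \subset W]]%SET| * 'C(n, q) <=
   #|matchings n q k| * k * 'C(#|W|, q))%N.
Proof.
(* If there is no [q]-set at all, then ['C(n, q)] is 0 and the bound is trivial. *)
have [E|[B0]] := set_0Vmem [set B : {set 'I_n} | #|B| == q]%SET.
  by have := card_draws 'I_n q; rewrite E cards0 card_ord => <-; rewrite muln0.
rewrite inE => /eqP B0q; pose d := #|matchings_through q k B0|.
have dE (B : {set 'I_n}) : #|B| == q -> #|matchings_through q k B| = d.
  by move=> /eqP Bq; apply: card_matchings_through; rewrite Bq.
have -> : (#|matchings n q k| * k = 'C(n, q) * d)%N.
  rewrite -sum_matchings_through (eq_bigr (fun=> d)) //.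
  rewrite sum_nat_const -[in RHS](card_ord n) -card_draws; congr (_ * _)%N.
  by apply: eq_card => B; rewrite inE.
suff: (#|[set M in matchings n q k | [exists B in M, B \subset W]]%SET| <=
       'C(#|W|, q) * d)%N.
  by move=> /(leq_mul (leqnn 'C(n, q))); rewrite mulnA [(_ * #|_|)%N]mulnC mulnAC.
apply: (@leq_trans #|(\bigcup_(B : {set 'I_n} | (B \subset W) && (#|B| == q))
                       matchings_through q k B)%SET|).
  apply/subset_leq_card/fintype.subsetP => M; rewrite [in X in X -> _]inE.
  move=> /andP[MM /existsP[B /andP[BM BW]]]; apply/bigcupP; exists B.
    by move: MM; rewrite BW inE => /and3P[_ _ /forallP/(_ B)]; rewrite BM.
  by rewrite [M \in _]inE MM.
apply: (@leq_trans (\sum_(B : {set 'I_n} | (B \subset W) && (#|B| == q)) d)).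
  elim/big_rec2: _ => [|B m U /andP[_ /dE <-] IH]; first by rewrite cards0.
  by rewrite (leq_trans (leq_card_setU _ _)) // leq_add2l.
rewrite sum_nat_const -cards_draws leq_mul2r; apply/orP; right.
by apply/subset_leq_card/fintype.subsetP => B; rewrite inE.
Qed.

(** * Derivations in a spanoid *)

(** Otherwise [U] is closed under the rules, so no derivation from [T] leaves [U]. *)
Lemma spanning_step n (S : spanoid n) (T U : {set 'I_n}) :
  spanoid_span S T = [set: 'I_n] -> T \subset U -> U != [set: 'I_n] ->
  exists2 i, i \notin U & exists2 B : {set 'I_n}, B \subset U & (B, i) \in S.
Proof.
move=> spT TU UT.
suff /existsP[i /andP[iU /existsP[B /andP[BU BS]]]] : [exists i, (i \notin U) &&
    [exists B : {set 'I_n}, (B \subset U) && ((B, i) \in S)]].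
  by exists i => //; exists B.
apply: contraT; rewrite negb_exists => /forallP closedU.
case/negP: UT; rewrite -finset.subTset -spT; apply/fintype.subsetP => i.
rewrite inE => /existsP[V /andP[/connectP[p]]].
elim: p T TU {spT} => [|V' p IHp] T TU /=; first by move=> _ ->; apply: (fintype.subsetP TU).
move=> /andP[/existsP[j /andP[/eqP V'E /existsP[B /andP[BT BjS]]]]].
apply: IHp; rewrite V'E finset.subUset TU andbT finset.sub1set.
apply: contraR (closedU j) => jU; rewrite jU /=.
by apply/existsP; exists B; rewrite BjS (fintype.subset_trans BT).
Qed.

(** Add a newly derivable element [s] times. The order of derivation is forgotten: premises are only
    located in the final [T :|: I], so the union bound ranges over sets, not sequences. *)
Lemma spanning_derivation n (S : spanoid n) (T : {set 'I_n}) s :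
  spanoid_span S T = [set: 'I_n] -> (#|T| + s <= n)%N ->
  exists2 I : {set 'I_n}, #|I| = s &
    forall i, i \in I -> exists2 B : {set 'I_n}, B \subset T :|: I & (B, i) \in S.
Proof.
move=> spT; elim: s => [|s IHs] Tsn.
  by exists finset.set0; [rewrite cards0|move=> i; rewrite inE].
have [|I Is HI] := IHs; first by lia.
have [||i iTI [B BTI BiS]] := @spanning_step _ S T (T :|: I) spT.
- exact: finset.subsetUl.
- apply: contraTneq Tsn => TI; rewrite -ltnNge.
  have [+ _] := leq_card_setU T I; rewrite TI cardsT card_ord Is; lia.
have iI : i \notin I by apply: contra iTI => iI; rewrite inE iI orbT.
have sub : T :|: I \subset T :|: (i |: I) by rewrite finset.setUS // finset.subsetUr.
exists (i |: I)%SET; first by rewrite cardsU1 iI Is.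
move=> j; rewrite in_setU1 => /orP[/eqP ->|/HI[C CTI CjS]].
  by exists B => //; apply: fintype.subset_trans BTI sub.
by exists C => //; apply: fintype.subset_trans CTI sub.
Qed.

Lemma rank_le_derivation n (S : spanoid n) r s :
  (spanoid_rank S <= r)%N -> (r + s <= n)%N ->
  exists T I : {set 'I_n}, [/\ #|T| = r, #|I| = s &
    forall i, i \in I -> exists2 B : {set 'I_n}, B \subset T :|: I & (B, i) \in S].
Proof.
have [[T spT <-] _] := spanoid_rank_min S => Tr rsn.
have [|I Is HI] := spanning_derivation spT (s := s); first by lia.
(* A minimum spanning set may have fewer than [r] elements; it is padded to size exactly [r], and
   the padding may meet [I]. *)
have [|T' [TT' _ T'r]] := @set_between _ T [set: 'I_n] r (finset.subsetT _).
  by rewrite cardsT card_ord Tr; lia.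
exists T', I; split=> // i /HI[B BTI BiS]; exists B => //.
by apply: fintype.subset_trans BTI _; apply: finset.setSU.
Qed.

(** * Estimates for binomial coefficients *)

Lemma leq_bin_exp2 n m : ('C(n, m) <= 2 ^ n)%N.
Proof.
rewrite -[n in 'C(n, _)]card_ord -card_draws -[n in (2 ^ n)%N]card_ord -cardsT -card_powerset.
by apply/subset_leq_card/fintype.subsetP => A _; rewrite powersetE finset.subsetT.
Qed.

Lemma leq_ffact_exp n m : (n ^_ m <= n ^ m)%N.
Proof.
elim: m => [|m IHm]; first by rewrite ffactn0.
by rewrite ffactnSr expnSr leq_mul ?leq_subr.
Qed.

Lemma leq_exp_ffact s m : (s ^ m <= (s + m) ^_ m)%N.
Proof.
elim: m => [|m IHm]; first by rewrite ffactn0.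
by rewrite addnS ffactSS expnS leq_mul // -addnS leq_addr.
Qed.

(* [s ^ s <= (2s)! / s! = 'C(2s, s) * s!] *)
Lemma leq_exp_fact s : (s ^ s <= 4 ^ s * s`!)%N.
Proof.
apply: leq_trans (leq_exp_ffact s s) _; rewrite -bin_ffact leq_mul //.
by rewrite -[4%N]/(2 ^ 2)%N -expnM mul2n -addnn leq_bin_exp2.
Qed.

Lemma leq_bin_exp n m : ('C(n, m) <= n ^ m)%N.
Proof.
apply: (@leq_trans (n ^_ m)); last exact: leq_ffact_exp.
by rewrite -bin_ffact leq_pmulr ?fact_gt0.
Qed.

(** Division-free form of ['C(n, s) <= (4 n / s) ^ s]. *)
Lemma bin_mul_exp_le n s : ('C(n, s) * s ^ s <= (4 * n) ^ s)%N.
Proof.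
rewrite (leq_trans (leq_mul (leqnn _) (leq_exp_fact s))) //.
by rewrite mulnCA expnMn bin_ffact leq_mul // leq_ffact_exp.
Qed.

(** The ratio of the two binomials is a product of factors [(w - j) / (n - j)], each at most
    [w / n]. *)
Lemma bin_ratio_le w n q : (w <= n)%N -> ('C(w, q) * n ^ q <= 'C(n, q) * w ^ q)%N.
Proof.
move=> wn; rewrite -(leq_pmul2r (fact_gt0 q)).
rewrite mulnAC bin_ffact [leqRHS]mulnAC bin_ffact.
elim: q => [|q IHq]; first by rewrite !ffactn0.
rewrite !ffactnSr !expnSr mulnACA [leqRHS]mulnACA leq_mul // !mulnBl.
by rewrite [(w * n)%N]mulnC leq_sub2l // leq_mul2l wn orbT.
Qed.

(** With [q = p + 3], this is [(4 n / s) * k * (2 s / n) ^ q <= 1 / 4] cleared of denominators; the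
    second hypothesis says [8 s <= X]. *)
Lemma failure_base_le n k p s : (2 * k <= n)%N -> ((8 * s) ^ p.+2 <= n ^ p.+1)%N ->
  (16 * (n * k * (2 * s) ^ p.+3) <= s * n ^ p.+3)%N.
Proof.
(* The factor [4 ^ (p + 2)] turns [(2 s) ^ (p + 2)] into [(8 s) ^ (p + 2)], to which [sn]
   applies. *)
move=> kn sn; rewrite -(@leq_pmul2l (4 ^ p.+2)) ?expn_gt0 //.
have -> : (4 ^ p.+2 * (16 * (n * k * (2 * s) ^ p.+3)) =
           16 * s * n * (2 * k) * (8 * s) ^ p.+2)%N.
  rewrite [((2 * s) ^ p.+3)%N]expnS (_ : 8 * s = 4 * (2 * s))%N; last by lia.
  rewrite (expnMn 4 (2 * s)); move: (4 ^ _)%N ((2 * s) ^ _)%N => a b; lia.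
have -> : (4 ^ p.+2 * (s * n ^ p.+3) = 16 * 4 ^ p * s * n * n * n ^ p.+1)%N.
  rewrite 2!(expnS 4) (expnS n p.+2) (expnS n p.+1).
  move: (4 ^ _)%N (n ^ _)%N => a b; lia.
apply: leq_mul sn; apply: leq_mul kn; rewrite leq_mul2r leq_mul2r leq_pmulr ?expn_gt0 ?orbT //.
Qed.

(** * The product law and the union bound *)

Lemma sum_uniform_mass_cond (R : realType) (T : finType) (A : {set T}) (P : pred T) :
  \sum_(x | P x) uniform_mass R A x = #|[set x in A | P x]%SET|%:R / #|A|%:R.
Proof.
rewrite (bigID (mem A)) /= addrC big1 ?add0r; last first.
  by move=> x /andP[_ /negPf xA]; rewrite /uniform_mass xA.
rewrite (eq_bigr (fun=> #|A|%:R^-1)); last by move=> x /andP[_ xA]; rewrite /uniform_mass xA.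
rewrite sumr_const -[LHS]mulr_natl; congr (_%:R / _).
by apply: eq_card => x; rewrite inE andbC.
Qed.

Lemma sum_uniform_mass (R : realType) (T : finType) (A : {set T}) :
  (0 < #|A|)%N -> \sum_x uniform_mass R A x = 1.
Proof.
move=> A0; rewrite sum_uniform_mass_cond (_ : finset _ = A) ?divff ?pnatr_eq0 -?lt0n //.
by apply/setP => x; rewrite inE andbT.
Qed.

Lemma uniform_mass_ge0 (R : realType) (T : finType) (A : {set T}) x : 0 <= uniform_mass R A x.
Proof. by rewrite /uniform_mass; case: ifP => // _; rewrite invr_ge0. Qed.

(** Fold the condition into the factors and distribute: coordinates in [I] give the mass of [P], the
    others the total mass 1. *)
Lemma prod_law_event (R : comPzRingType) (J T : finType) (mu : T -> R) (I : {set J}) (P : pred T) :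
  \sum_x mu x = 1 ->
  \sum_(f : {ffun J -> T} | [forall i in I, P (f i)]) \prod_i mu (f i) =
  (\sum_(x | P x) mu x) ^+ #|I|.
Proof.
move=> mu1.
pose G i x := if (i \in I) ==> P x then mu x else 0.
transitivity (\sum_(f : {ffun J -> T}) \prod_i G i (f i)).
  rewrite [LHS]big_mkcond; apply: eq_bigr => f _; case: ifPn => [/forallP fI|].
    by apply: eq_bigr => i _; rewrite /G fI.
  by rewrite negb_forall => /existsP[i fi]; rewrite (bigD1 i) //= /G (negPf fi) mul0r.
rewrite -bigA_distr_bigA -prodr_const [RHS]big_mkcond /=; apply: eq_bigr => i _.
rewrite /G; case: (i \in I) => /=; last exact: mu1.
by rewrite [RHS]big_mkcond.
Qed.

Lemma prob_matching_sub (R : realType) n q k w (W : {set 'I_n}) :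
  (0 < q <= n)%N -> (k * q <= n)%N -> (#|W| <= w <= n)%N ->
  \sum_(M : {set {set 'I_n}} | [exists B in M, B \subset W]) uniform_mass R (matchings n q k) M
    <= k%:R * (w%:R / n%:R) ^+ q.
Proof.
move=> /andP[q0 qn] kqn /andP[Ww wn].
have n0 : (0 < n)%N by apply: leq_trans qn.
rewrite sum_uniform_mass_cond ler_pdivrMr ?ltr0n ?matchings_gt0 //.
rewrite expr_div_n mulrA mulrAC ler_pdivlMr ?exprn_gt0 ?ltr0n //.
rewrite -!natrX -!natrM ler_nat.
rewrite -(@leq_pmul2l 'C(n, q)) ?bin_gt0 //.
have H1 := card_matchings_sub q k W; have H2 := bin_ratio_le q wn.
have H3 : ('C(#|W|, q) <= 'C(w, q))%N by apply: leq_bin2l.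
rewrite mulnCA mulnA [leqRHS](_ : _ = #|matchings n q k| * k * ('C(n, q) * w ^ q))%N; last by ring.
apply: leq_trans (leq_mul H1 (leqnn _)) _.
by rewrite -mulnA leq_mul // (leq_trans (leq_mul H3 (leqnn _))).
Qed.

Lemma random_spanoid_probC (R : realType) n q (E : pred (spanoid n)) : (0 < q)%N ->
  1 - random_spanoid_prob R q E = random_spanoid_prob R q (fun S => ~~ E S).
Proof.
move=> q0; set mt := matchings n q (n %/ (2 * q)).
have mt0 : (0 < #|mt|)%N by rewrite matchings_gt0 //; have := leq_trunc_div n (2 * q); lia.
have := @bigA_distr_bigA R 0 1 *%R +%R 'I_n {set {set 'I_n}} (fun=> uniform_mass R mt).
rewrite big1 => [tot|i _]; last exact: sum_uniform_mass.
by rewrite [in LHS]tot (bigID (fun M => E (spanoid_of M))) /= addrC addKr.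
Qed.

Lemma random_spanoid_prob_ge0 (R : realType) n q (E : pred (spanoid n)) :
  0 <= random_spanoid_prob R q E.
Proof. by apply: sumr_ge0 => M _; apply: prodr_ge0 => i _; apply: uniform_mass_ge0. Qed.

(** Union bound over [T] and [I]. The event [E] is left general so that a real-valued rank threshold
    can be used. *)
Lemma prob_rank_le (R : realType) n q r s (E : pred (spanoid n)) :
  (0 < q <= n)%N -> (r + s <= n)%N -> (forall S, E S -> (spanoid_rank S <= r)%N) ->
  random_spanoid_prob R q E <=
  'C(n, r)%:R * 'C(n, s)%:R * ((n %/ (2 * q))%:R * ((r + s)%:R / n%:R) ^+ q) ^+ s.
Proof.
move=> /andP[q0 qn] rsn Er; set k := (n %/ (2 * q))%N.
have kqn : (k * q <= n)%N by have := leq_trunc_div n (2 * q); rewrite -/k; lia.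
pose mass (M : {ffun 'I_n -> {set {set 'I_n}}}) :=
  \prod_(i < n) uniform_mass R (matchings n q k) (M i).
pose bad (p : {set 'I_n} * {set 'I_n}) (M : {ffun 'I_n -> {set {set 'I_n}}}) :=
  [forall i in p.2, [exists B in M i, B \subset p.1 :|: p.2]].
pose D := finset.setX [set T : {set 'I_n} | #|T| == r]%SET [set I : {set 'I_n} | #|I| == s]%SET.
have mass_ge0 M : 0 <= mass M by apply: prodr_ge0 => i _; apply: uniform_mass_ge0.
(* Every outcome in [E] is bad for at least one pair of [D], so the double sum counts its mass. *)
apply: (@le_trans _ _ (\sum_(p in D) \sum_(M | bad p M) mass M)).
  rewrite (exchange_big_dep predT) //= [leLHS]/random_spanoid_prob big_mkcond /=.
  apply: ler_sum => M _; case: ifPn => [EM|_]; last exact: sumr_ge0.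
  have [T [I [Tr Is HI]]] := rank_le_derivation (Er _ EM) rsn.
  rewrite (bigD1 (T, I)) /= ?lerDl ?sumr_ge0 //.
  rewrite !inE /= Tr Is !eqxx /=; apply/forall_inP => i /HI[B BTI].
  by rewrite inE /= => BM; apply/existsP; exists B; rewrite BM.
have -> : 'C(n, r)%:R * 'C(n, s)%:R = #|D|%:R :> R.
  by rewrite cardsX !card_draws card_ord natrM.
rewrite [leRHS]mulr_natl -sumr_const; apply: ler_sum => -[T I].
rewrite !inE /= => /andP[/eqP Tr /eqP Is].
rewrite /bad /mass /= (prod_law_event (mu := uniform_mass R (matchings n q k)) I
  (fun M : {set {set 'I_n}} => [exists B in M, B \subset T :|: I])); last first.
  by rewrite sum_uniform_mass ?matchings_gt0.
rewrite Is lerXn2r ?nnegrE ?sumr_ge0 ?mulr_ge0 ?exprn_ge0 ?divr_ge0 // => [M _|].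
  exact: uniform_mass_ge0.
apply: prob_matching_sub; rewrite ?q0 ?qn ?rsn ?andbT //.
by have [+ _] := leq_card_setU T I; rewrite Tr Is.
Qed.

(* Here [q = p + 3], which avoids truncated subtraction in [q - 1] and [q - 2]. *)
Lemma union_bound_le (R : realType) n k p r s :
  (0 < s)%N -> (r <= s)%N -> (2 * k <= n)%N -> ((8 * s) ^ p.+2 <= n ^ p.+1)%N ->
  'C(n, r)%:R * 'C(n, s)%:R * (k%:R * ((r + s)%:R / n%:R) ^+ p.+3) ^+ s <=
  n%:R ^+ r / 4 ^+ s :> R.
Proof.
move=> s0 rs kn sn.
have n0 : (0 < n)%N.
  rewrite lt0n; apply: contraTneq sn => ->.
  by rewrite exp0n // -ltnNge expn_gt0; lia.
have n0R : 0 < n%:R :> R by rewrite ltr0n.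
have s0R : 0 < s%:R :> R by rewrite ltr0n.
have n_le : 'C(n, r)%:R <= n%:R ^+ r :> R by rewrite -natrX ler_nat leq_bin_exp.
have s_le : 'C(n, s)%:R <= (4 * n%:R / s%:R) ^+ s :> R.
  rewrite expr_div_n ler_pdivlMr ?exprn_gt0 // -!natrM -!natrX -natrM ler_nat.
  exact: bin_mul_exp_le.
have base_ge0 m : 0 <= k%:R * (m%:R / n%:R) ^+ p.+3 :> R.
  by rewrite mulr_ge0 ?exprn_ge0 ?divr_ge0.
have k_le : k%:R * ((r + s)%:R / n%:R) ^+ p.+3 <= k%:R * ((2 * s)%:R / n%:R) ^+ p.+3 :> R.
  rewrite ler_wpM2l // lerXn2r ?nnegrE ?divr_ge0 // ler_pM2r ?invr_gt0 //.
  by rewrite ler_nat; lia.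
have ns_ge0 : 0 <= 4 * n%:R / s%:R :> R by rewrite divr_ge0 ?mulr_ge0.
have base_le : 4 * n%:R / s%:R * (k%:R * ((2 * s)%:R / n%:R) ^+ p.+3) <= 4^-1 :> R.
  have := failure_base_le kn sn; rewrite -(ler_nat R) expr_div_n -!natrX.
  move: ((2 * s) ^ _)%N (n ^ p.+3)%N (expn_gt0 n p.+3) => a b.
  rewrite n0 !natrM -(ltr0n R) /= => b0 H.
  rewrite [leLHS](_ : _ = 16 * (n%:R * k%:R * a%:R) / (s%:R * b%:R) / 4); last first.
    by field; rewrite !gt_eqF.
  by rewrite ler_pdivrMr // mulVf // ler_pdivrMr ?mulr_gt0 // mul1r.
rewrite -exprVn -mulrA ler_pM // ?mulr_ge0 ?exprn_ge0 //.
(* Merge the bound on ['C(n, s)] into the [s]-th power, using [r + s <= 2 s]; the new base is at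
   most [1 / 4]. *)
apply: (@le_trans _ _ ((4 * n%:R / s%:R * (k%:R * ((2 * s)%:R / n%:R) ^+ p.+3)) ^+ s)).
  by rewrite [leRHS]exprMn ler_pM ?exprn_ge0 // lerXn2r ?nnegrE.
by rewrite lerXn2r ?nnegrE ?invr_ge0 ?(mulr_ge0 ns_ge0 (base_ge0 _)).
Qed.

(** * Choice of parameters and the limit *)

(** The exponent is at least [1 / 2], so the power dominates the square root of [n], uniformly in
    [p]. *)
Lemma powR_exponent_ge (R : realType) n p Y : (0 < n)%N -> (Y ^ 2 <= n)%N ->
  Y%:R <= n%:R `^ (p.+1%:R / p.+2%:R) :> R.
Proof.
move=> n0 Yn; apply: (@le_trans _ _ (n%:R `^ 2^-1)).
  rewrite powR12_sqrt // -[Y%:R]ger0_norm // -sqrtr_sqr ler_wsqrtr //.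
  by rewrite -natrX ler_nat.
rewrite ler_powR ?ler1n // ler_pdivlMr ?ltr0n // mulrC ler_pdivrMr // -natrM ler_nat; lia.
Qed.

Lemma prob_small_rank_le (R : realType) n p K :
  (p.+3 <= n)%N -> ((8 * K.+2) ^ 2 <= n)%N ->
  random_spanoid_prob R p.+3 (fun S : spanoid n =>
    ~~ (16^-1 * n%:R `^ (p.+1%:R / p.+2%:R) / log2 n%:R < (spanoid_rank S)%:R :> R))
  <= (2 ^+ K)^-1.
Proof.
move=> pn Kn; have n0 : (0 < n)%N by apply: leq_trans pn.
have n0R : 0 < n%:R :> R by rewrite ltr0n.
set X := n%:R `^ _; set rho := _ / log2 _.
have KX : (8 * K.+2)%:R <= X by apply: powR_exponent_ge.
have X16 : 16 <= X by apply: le_trans KX; rewrite ler_nat; lia.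
have Xn : X <= n%:R by rewrite ler1_powR ?ler1n // ler_pdivrMr ?ltr0n // mul1r ler_nat.
have ln2_gt0 : 0 < ln 2 :> R by rewrite ln_gt0 // ltr1n.
have ln2n : ln 2 <= ln n%:R :> R by rewrite ler_ln ?posrE // ler_nat; lia.
have lnn_gt0 : 0 < ln n%:R :> R by apply: lt_le_trans ln2n.
have log2_gt0 : 0 < log2 n%:R :> R by rewrite divr_gt0.
have rho_ge0 : 0 <= rho by rewrite divr_ge0 ?mulr_ge0 ?powR_ge0 ?invr_ge0 // ltW.
(* Here [log2 n >= 1], since [n >= 2]. *)
have rhoX : rho <= X / 16.
  rewrite ler_pdivrMr // [leLHS]mulrC ler_peMr ?divr_ge0 ?powR_ge0 //.
  by rewrite ler_pdivlMr // mul1r.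
pose r := Num.truncn rho; pose s := Num.truncn (X / 8).
have /andP[r_le _] : r%:R <= rho < r.+1%:R by apply: truncn_itv.
have /andP[s_le s_gt] : s%:R <= X / 8 < s.+1%:R by apply: truncn_itv; lra.
move: s_gt; rewrite -[s.+1%:R]natr1 => s_gt.
(* Truncation loses less than 1, and [X / 16 >= 1] absorbs it. *)
have Xs : X / 16 <= s%:R by lra.
have Ks : (K < s)%N.
  rewrite -(ltr_nat R); move: KX.
  by rewrite natrM -[K.+2%:R]natr1 -[K.+1%:R]natr1; lra.
have rs : (r <= s)%N by rewrite -(ler_nat R); lra.
have sn : (8 * s <= n)%N by rewrite -(ler_nat R) natrM; lra.
(* Since [8 s <= X] and [X ^ (p + 2) = n ^ (p + 1)]. *)
have spow : ((8 * s) ^ p.+2 <= n ^ p.+1)%N.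
  rewrite -(ler_nat R) !natrX -[n%:R ^+ _]powR_mulrn //.
  rewrite -[p.+1%:R](@divfK _ p.+2%:R) ?pnatr_eq0 // powRrM powR_mulrn ?powR_ge0 //.
  by rewrite lerXn2r ?nnegrE ?powR_ge0 // natrM -/X; lra.
(* In logarithms: [r * log2 n <= rho * log2 n = X / 16 <= s]. *)
have nr : n%:R ^+ r <= 2 ^+ s :> R.
  rewrite -ler_ln ?posrE ?exprn_gt0 // !lnXn // -[_ *+ r]mulr_natl -[_ *+ s]mulr_natl.
  apply: (@le_trans _ _ (X / 16 * ln 2)); last by rewrite ler_pM2r.
  apply: (@le_trans _ _ (rho * ln n%:R)); first by rewrite ler_pM2r.
  rewrite /rho /log2 -/X [leLHS](_ : _ = X / 16 * ln 2) //.
  by field; rewrite !gt_eqF.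
set E := fun S : spanoid n => _.
have Er (S : spanoid n) : E S -> (spanoid_rank S <= r)%N.
  by rewrite /E -leNgt truncn_ge_nat.
have kn : (2 * (n %/ (2 * p.+3)) <= n)%N.
  by apply: leq_trans (leq_trunc_div n (2 * p.+3)); rewrite mulnC leq_mul2l leq_pmulr // orbT.
have s0 : (0 < s)%N by apply: leq_trans Ks.
have rsn : (r + s <= n)%N.
  apply: leq_trans (leq_add rs (leqnn s)) (leq_trans _ sn).
  by rewrite addnn -mul2n leq_mul2r orbT.
have pn0 : (0 < p.+3 <= n)%N by [].
have prob_le := prob_rank_le R pn0 rsn Er.
have bound_le := union_bound_le R s0 rs kn spow.
apply: le_trans prob_le _; apply: le_trans bound_le _.
(* Finally [n ^ r / 4 ^ s <= 2 ^ s / 4 ^ s = 2 ^ - s <= 2 ^ - K]. *)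
rewrite (_ : 4 = 2 * 2 :> R); last by rewrite -natrM.
rewrite exprMn ler_pdivrMr ?mulr_gt0 ?exprn_gt0 // mulrA.
apply: le_trans nr _; rewrite ler_peMl ?exprn_ge0 //.
by rewrite ler_pdivlMl ?exprn_gt0 // mulr1 ler_eXn2l ?ltr1n // ltnW.
Qed.

Local Open Scope classical_set_scope.
Local Open Scope ring_scope.

Theorem mainTheorem3 (R : realType) :
  exists c : R, 0 < c < 1 /\
    forall q : nat, (3 <= q)%N ->
      (fun n : nat => random_spanoid_prob R q
         (fun S : spanoid n =>
            (spanoid_rank S)%:R > c * (n%:R `^ ((q%:R - 2) / (q%:R - 1))) / log2 n%:R))
        @ \oo --> (1 : R).
Proof.
exists 16^-1; split; first by apply/andP; split; lra.
move=> [|[|[|p]]] // _; apply/cvgrPdist_le => e e0.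
(* This works because [1 / e < K + 1 <= 2 ^ K]. *)
pose K := Num.truncn e^-1.
have Ke : (2 ^+ K)^-1 <= e.
  rewrite invf_ple ?posrE ?exprn_gt0 //; apply: le_trans (ltW (truncnS_gt _)) _.
  by rewrite -natrX ler_nat ltn_expl.
exists (p.+3 + (8 * K.+2) ^ 2)%N => // n /= Nn.
rewrite random_spanoid_probC // ger0_norm ?random_spanoid_prob_ge0 //.
rewrite (_ : p.+3%:R - 2 = p.+1%:R); last by rewrite -natrB // subSS subSS subn0.
rewrite (_ : p.+3%:R - 1 = p.+2%:R); last by rewrite -[p.+3%:R]natr1 addrK.
by apply: le_trans Ke; apply: prob_small_rank_le; lia.
Qed.
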